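(* Let $R$ be a commutative ring with identity $e$ and let $I=\{a\in R : a^2=a\}$, regarded as a lattice under $a\vee b=a+b-ab$ and $a\wedge b=ab$. Suppose that: 1. $I$ is a complete lattice, and for every subset $H\subseteq I$ there exist (at most) countable subsets $\{a_n\}$ and $\{b_n\}$ of $H$ such that $\bigvee H=\bigvee\{a_n\}$ and $\bigwedge H=\bigwedge\{b_n\}$; 2. for each $a\in R$ there exists $a^{-1}\in R$ such that $i_{a^{-1}}=i_a$ and $a^{-1}a=i_a$; 3. $R$ has the countable concatenation property. Suppose moreover that $R$, viewed as a module over itself, is separated by countable partitions of $e$. Then every finitely generated unitary $R$-module $M$ that is separated by countable partitions of $e$ has a quasi-basis; and if $\{x_1,\dots,x_n\}$ and $\{y_1,\dots,y_m\}$ are two quasi-bases for $M$, then $n=m$ and $i_{x_j}=i_{y_j}$ for $1\le j\le n$.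
   Context: Order on $I$: for $i,j\in I$, $i\le j$ means $ij=i$ (the order induced by $\vee$ and $\wedge$); $0$ is the least element and $e$ the greatest. Countable partition of $e$: a family $\{i_n ; n\ge 1\}$ in $I$ with $i_mi_n=0$ for $m\ne n$ and $\bigvee_n i_n=e$. Separated by countable partitions: a unitary $R$-module $M$ is separated by countable partitions of $e$ if for all $x,y\in M$, whenever there is a countable partition $\{i_n ; n\ge1\}$ of $e$ with $i_nx=i_ny$ for every $n$, then $x=y$. Countable concatenation property of $R$: for every countable partition $\{i_n ; n\ge1\}$ of $e$ and every sequence $(a_n)_{n\ge1}$ in $R$ there is $a\in R$ with $i_na=i_na_n$ for all $n$. The element $i_x$: let $M$ be a unitary $R$-module with null element $\theta$ that is separated by countable partitions of $e$. For $x\in M$, $i_x$ denotes the minimum element of $\{i\in I : ix=x\}$ (it exists under the assumption on $I$ in item 1 and separatedness of $M$; equivalently $i_x=e-\bigvee\{i\in I : ix=\theta\}$). In particular $i_\theta=0$. For $a\in R$, $i_a$ is defined in the same way, viewing $R$ as a module over itself. Quasi-basis: a subset $\{x_1,x_2,\dots,x_n\}$ of $M$ is called a quasi-basis for $M$ if (a) $M=\mathrm{span}_R\{x_1,\dots,x_n\}$; (b) $i_{x_1}\ge i_{x_2}\ge\cdots\ge i_{x_n}$; (c) for all $a_1,\dots,a_n\in R$, $\sum_{j=1}^n a_jx_j=\theta$ implies $a_ji_{x_j}=0$ for all $1\le j\le n$.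
   Formalization: The equality n=m is stated for quasi-bases with no null element, since adjoining θ to a quasi-basis gives another one (over a field, {1} and {1,0}); existence gives nonzero elements, and i_{x_j}=i_{y_j} holds at all common indices. *)

(* Defs.v *)
From HB Require Import structures.
From mathcomp Require Import all_boot all_order all_algebra.
From mathcomp Require Import boolp classical_sets functions cardinality.
From mathcomp Require Import ring.
Set Implicit Arguments.
Unset Strict Implicit.
Unset Printing Implicit Defensive.
Import Order.TTheory GRing.Theory.
Local Open Scope classical_set_scope.
Local Open Scope ring_scope.

Section Idempotents.
Variable R : comPzRingType.

Record idem := Idem { idem_val : R; _ : idem_val * idem_val == idem_val }.
HB.instance Definition _ := [isSub for idem_val].
HB.instance Definition _ := [Choice of idem by <:].

Implicit Types i j : idem.

Lemma idemK i : val i * val i = val i. Proof. by case: i => a /= /eqP. Qed.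

Fact idem_zero_subproof : (0 : R) * 0 == 0. Proof. by rewrite mul0r. Qed.
Fact idem_one_subproof : (1 : R) * 1 == 1. Proof. by rewrite mul1r. Qed.
Fact idem_meet_subproof i j : val i * val j * (val i * val j) == val i * val j.
Proof. by rewrite mulrACA !idemK. Qed.
Fact idem_join_subproof i j :
  (val i + val j - val i * val j) * (val i + val j - val i * val j)
    == val i + val j - val i * val j.
Proof.
have [Hi Hj] := (idemK i, idemK j); apply/eqP.
move: (val i) (val j) Hi Hj => a b Ha Hb.
have -> : (a + b - a * b) * (a + b - a * b) =
  a * a + b * b + a * b + a * b - (a * a) * b - a * (b * b)
  - (a * a) * b - a * (b * b) + (a * a) * (b * b) by ring.
by rewrite Ha Hb; ring.
Qed.

Definition idem0 := Idem idem_zero_subproof.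
Definition idem1 := Idem idem_one_subproof.
Definition idem_meet i j := Idem (idem_meet_subproof i j).
Definition idem_join i j := Idem (idem_join_subproof i j).
Definition idem_le i j := idem_meet i j == i.
Definition idem_lt i j := (j != i) && idem_le i j.

Fact idem_meetC : commutative idem_meet.
Proof. by move=> i j; apply/val_inj; rewrite /= mulrC. Qed.
Fact idem_joinC : commutative idem_join.
Proof. by move=> i j; apply/val_inj; rewrite /=; ring. Qed.
Fact idem_meetA : associative idem_meet.
Proof. by move=> i j k; apply/val_inj; rewrite /= mulrA. Qed.
Fact idem_joinA : associative idem_join.
Proof. by move=> [a Ha] [b Hb] [c Hc]; apply/val_inj; rewrite /=; ring. Qed.
Fact idem_joinKI j i : idem_meet i (idem_join i j) = i.
Proof. by apply/val_inj; rewrite /= mulrBr mulrDr mulrA !idemK addrK. Qed.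
Fact idem_meetKU j i : idem_join i (idem_meet i j) = i.
Proof. by apply/val_inj; rewrite /= mulrA !idemK addrK. Qed.
Fact idem_meetUl : left_distributive idem_meet idem_join.
Proof.
move=> [a Ha] [b Hb] [c Hc]; apply/val_inj; rewrite /=.
have -> : a * c * (b * c) = a * b * (c * c) by ring.
by rewrite (eqP Hc); ring.
Qed.
Fact idem_meetxx : idempotent_op idem_meet.
Proof. by move=> i; apply/val_inj; rewrite /= idemK. Qed.

Fact idem_display : Order.disp_t. Proof. exact: Order.Disp tt tt. Qed.

HB.instance Definition _ := @Order.isMeetJoinDistrLattice.Build idem_display
  idem idem_le idem_lt idem_meet idem_join (fun _ _ => erefl) (fun _ _ => erefl)
  idem_meetC idem_joinC idem_meetA idem_joinA idem_joinKI idem_meetKU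
  idem_meetUl idem_meetxx.

Fact idem_le0x i : (idem0 <= i)%O.
Proof. by apply/eqP/val_inj; rewrite /= mul0r. Qed.
Fact idem_lex1 i : (i <= idem1)%O.
Proof. by apply/eqP/val_inj; rewrite /= mulr1. Qed.

HB.instance Definition _ :=
  @Order.hasBottom.Build idem_display idem idem0 idem_le0x.
HB.instance Definition _ :=
  @Order.hasTop.Build idem_display idem idem1 idem_lex1.

Lemma idem_leE i j : (i <= j)%O <-> val i * val j = val i.
Proof.
split; first by move/eqP => /(congr1 idem_val).
by move=> H; apply/eqP/val_inj.
Qed.
Lemma idem_val_meet i j : val (i `&` j)%O = val i * val j. Proof. by []. Qed.
Lemma idem_val_join i j : val (i `|` j)%O = val i + val j - val i * val j.
Proof. by []. Qed.
Lemma idem_val_bot : val (\bot%O : idem) = 0. Proof. by []. Qed.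
Lemma idem_val_top : val (\top%O : idem) = 1. Proof. by []. Qed.

Definition idem_complete : Prop := forall H : set idem,
  (exists s, supremums H s) /\ (exists s, infimums H s).

(* [supremums H] and [infimums H] are sets with at most one element, so the
   equalities say that H and its countable subset have the same supremum
   (resp. infimum). *)
Definition idem_countable_type : Prop := forall H : set idem,
  (exists A, [/\ A `<=` H, countable A & supremums A = supremums H]) /\
  (exists B, [/\ B `<=` H, countable B & infimums B = infimums H]).

(* Members of a countable partition may be 0, and are indexed from 0 here. *)
Definition countable_partition (i : nat -> idem) : Prop :=
  (forall m n, m <> n -> val (i m) * val (i n) = 0) /\ supremums (range i) \top%O.

Definition separated_by_partitions (M : lmodType R) : Prop :=
  forall x y : M,
    (exists2 i : nat -> idem, countable_partition i &
       forall n, val (i n) *: x = val (i n) *: y) ->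
    x = y.

Definition countable_concatenation : Prop :=
  forall (i : nat -> idem) (a : nat -> R), countable_partition i ->
  exists b : R, forall n, val (i n) * b = val (i n) * a n.

(* [supp x] is the minimum element i_x of {i | i x = x}. The value is the junk
   value 0 if there is no minimum, which cannot happen if the idempotents satisfy
   [idem_complete] and [idem_countable_type] and M is separated by partitions. *)
Definition supp (M : lmodType R) (x : M) : idem :=
  let fixing := [set i : idem | val i *: x = x] in
  xget \bot%O (fixing `&` lbound fixing).

(* The regular module R^o makes [supp] compute i_a for a in R. *)
Definition quasi_invertible : Prop := forall a : R,
  exists2 b : R, supp (b : R^o) = supp (a : R^o) & b * a = val (supp (a : R^o)).

Definition spanning (M : lmodType R) n (x : 'I_n -> M) : Prop :=
  forall y : M, exists a : 'I_n -> R, y = \sum_(j < n) a j *: x j.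

Definition finitely_generated (M : lmodType R) : Prop :=
  exists n (x : 'I_n -> M), spanning x.

(* The x j may vanish here: appending 0 to a quasi-basis gives a quasi-basis, so
   the length is an invariant only for quasi-bases with nonzero elements.
   Nonzero elements of a quasi-basis are automatically distinct. *)
Definition quasi_basis (M : lmodType R) n (x : 'I_n -> M) : Prop :=
  [/\ spanning x,
      forall j k : 'I_n, (j <= k)%N -> (supp (x k) <= supp (x j))%O &
      forall a : 'I_n -> R, \sum_(j < n) a j *: x j = 0 ->
        forall j : 'I_n, a j * val (supp (x j)) = 0].

End Idempotents.

(* Main.v *)
Require Import Defs.
From mathcomp Require Import all_boot all_order all_algebra.
From mathcomp Require Import boolp classical_sets functions cardinality.
From mathcomp Require Import ring.
Import Order.TTheory GRing.Theory.
Local Open Scope classical_set_scope.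
Local Open Scope ring_scope.

Set Implicit Arguments.
Unset Strict Implicit.
Unset Printing Implicit Defensive.

(** The ring is von Neumann regular: every principal ideal is generated by an
    idempotent, so [M] behaves like a family of vector spaces over the Boolean
    algebra of idempotents, and the support of [x] is the region where [x] does
    not vanish. A quasi-basis is a direct decomposition into cyclic modules
    whose supports decrease; the supports record the regions where the local
    dimension is at least 1, at least 2, and so on.

    Everything infinite is packed into one principle: the supremum of a downward
    closed set of idempotents is exhausted by a countable partition into members
    of the set ([exhausting_partition]). Separatedness of [M] then turns a local
    equality into a global one, which produces supports ([suppP]); adding
    countable concatenation glues local coefficients, which produces, for a
    finite family and a vector [y], the largest idempotent [q] such that [q y]
    lies in the span of the family ([largest_part_in_span]).

    Existence. Generators are treated one at a time. Given a family with
    decreasing supports and direct span, the next generator [y] is replaced by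
    [z = (1 - q) y]. By maximality of [q] and regularity of the ring, the span of
    [z] meets the old span in 0 only ([direct_complement]). To restore the
    decreasing order, [z] is distributed over the family: the k-th vector [x k]
    receives the part of [z] living where [x (k-1)] is alive and [x k] is dead,
    with no condition on [x (k-1)] when k = 0.
    These regions partition the unit, so neither span nor directness is lost
    ([insert_span_new], [insert_independent]). Zero vectors sit at the end and
    can be dropped ([quasi_basis_trim]).

    Uniqueness. On a region [p] where [x 0, ..., x j] are alive but
    [y j, y (j+1), ...] are dead, the first j vectors of [y] generate [p M],
    which projects onto a free module of rank j+1 over [p R]. This factors [p]
    times the identity matrix of size j+1 through size j, so its determinant [p]
    vanishes ([free_rank_le]). *)

(** * Complements and exhausting partitions *)

Section Idempotents.
Variable R : comPzRingType.
Implicit Types i j q : idem R.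

Fact idem_compl_subproof i : (1 - val i) * (1 - val i) == 1 - val i.
Proof. by apply/eqP; ring: (idemK i). Qed.

Definition idem_compl i := Idem (idem_compl_subproof i).

Lemma idem_val_compl i : val (idem_compl i) = 1 - val i. Proof. by []. Qed.

Definition idem_valE :=
  (idem_val_compl, @idem_val_meet R, @idem_val_join R, @idem_val_bot R,
   @idem_val_top R).

Lemma idem_le_mul i j : (i <= j)%O -> val i * val j = val i.
Proof. by move/idem_leE. Qed.

(** A default value [t0] outside [A] lets one sequence serve the empty set as
    well, at the price of staying only inside [H]. *)
Lemma countable_enum (T : Type) (t0 : T) (A H : set T) :
  countable A -> A `<=` H -> H t0 ->
  exists f : nat -> T, (forall n, H (f n)) /\ (forall t, A t -> exists n, f n = t).
Proof.
move=> Acnt AH Ht0.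
have [A0|[f]] := pfcard_geP Acnt.
  by exists (fun=> t0); split=> // t; rewrite A0.
exists f; split=> [n|t At]; first exact/AH/(@funS _ _ _ _ f).
by have [n _ <-] := @surj _ _ _ _ f t At; exists n.
Qed.

(** What is left of the unit once [f 0, ..., f (n-1)] have been removed. *)
Fixpoint remainder (f : nat -> idem R) n : idem R :=
  if n is k.+1 then (remainder f k `&` idem_compl (f k))%O else \top%O.

Lemma remainder_mul f n m : (n < m)%N -> val (remainder f m) * val (f n) = 0.
Proof.
elim: m => // m IH; rewrite ltnS leq_eqVlt !idem_valE => /predU1P[->|/IH H].
  by ring: (idemK (f m)).
by rewrite mulrAC H mul0r.
Qed.

(** A countable subset of [H] already has supremum [q]; making an enumeration of
    it disjoint keeps the pieces in [H], since [H] is downward closed. The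
    complement of [q] comes first in the partition. *)
Lemma exhausting_partition (Icountable : idem_countable_type R)
    (H : set (idem R)) q :
    (forall i j, H j -> (i <= j)%O -> H i) -> H \bot%O -> supremums H q ->
  exists2 i : nat -> idem R, countable_partition i &
    i 0%N = idem_compl q /\ forall n, H (i n.+1).
Proof.
move=> Hdown H0 supq.
have [[A [AH Acnt supA]] _] := Icountable H.
have [f [Hf Af]] := countable_enum Acnt AH H0.
have fq n : val (f n) * val q = val (f n).
  by apply/idem_leE; case: supq => + _; apply.
pose d n := (remainder f n `&` f n)%O.
have dd m n : (m < n)%N -> val (d m) * val (d n) = 0.
  by move=> mn; rewrite !idem_valE; ring: (remainder_mul f mn).
exists (fun n => if n is k.+1 then d k else idem_compl q).
  split.
    case=> [|m] [|n] mn //; rewrite ?idem_valE.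
    - by ring: (fq n).
    - by ring: (fq m).
    - case: (ltngtP m n) => [/dd//|/dd|mnE]; first by rewrite mulrC.
      by case: mn; rewrite mnE.
  (* An upper bound u of the pieces d n dominates every f n: outside u nothing
     has been removed before step n, and what d n removes there is f n itself. *)
  split=> [|u ubu]; first by move=> i _; exact: lex1.
  have ulb n : val (d n) * val u = val (d n).
    by apply/idem_leE/ubu; exists n.+1.
  have compl_f n : (1 - val u) * val (remainder f n) = 1 - val u ->
      (1 - val u) * val (f n) = 0.
    by move=> <-; have := ulb n; rewrite idem_valE => dnu; ring: dnu.
  have rem_compl n : (1 - val u) * val (remainder f n) = 1 - val u.
    elim: n => [|n IH]; first by rewrite idem_valE mulr1.
    by rewrite !idem_valE mulrA IH mulrBr mulr1 compl_f ?subr0.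
  have uA : ubound A u.
    move=> t /Af[n <-]; apply/idem_leE.
    by apply/esym/eqP; rewrite -subr_eq0 -{1}[val (f n)]mulr1 -mulrBr mulrC compl_f.
  have [_ /(_ u uA) /idem_leE qu] : supremums A q by rewrite supA.
  have /idem_leE cqu : (idem_compl q <= u)%O by apply: ubu; exists 0%N.
  apply/idem_leE; rewrite !idem_valE mul1r.
  by move: cqu; rewrite idem_valE mulrBl mul1r qu => /addIr.
split=> // n; apply: Hdown (Hf n) _.
by apply/idem_leE; rewrite !idem_valE; ring: (idemK (f n)).
Qed.
End Idempotents.

(** * Supports *)

Section Supports.
Variable R : comPzRingType.
Hypothesis Icomplete : idem_complete R.
Hypothesis Icountable : idem_countable_type R.

(** The partition exhausting the supremum of a set of idempotents reduces a
    local assertion about that supremum to the members of the set. *)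
Lemma local_on_supremum (H : set (idem R)) :
    (forall i j, H j -> (i <= j)%O -> H i) -> H \bot%O ->
  exists2 q : idem R, ubound H q &
    exists2 i : nat -> idem R, countable_partition i &
      val (i 0%N) * val q = 0 /\ forall n, H (i n.+1).
Proof.
move=> Hdown H0; have [[q supq] _] := Icomplete H.
have [i ipart [i0 Hi]] := exhausting_partition Icountable Hdown H0 supq.
exists q; first by case: supq.
by exists i => //; split=> //; rewrite i0 idem_valE; ring: (idemK q).
Qed.

Section Module.
Variable M : lmodType R.
Hypothesis Msep : separated_by_partitions M.
Implicit Types (x y : M) (i : idem R).

(** The complement of the supremum of the annihilating idempotents fixes [x],
    because [x] vanishes on that supremum piece by piece. *)
Lemma suppP x : val (supp x) *: x = x /\ forall i : idem R, val i *: x = x -> (supp x <= i)%O.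
Proof.
pose H : set (idem R) := [set i | val i *: x = 0].
have Hdown i j : H j -> (i <= j)%O -> H i.
  by rewrite /H/mkset => Hj /idem_le_mul <-; rewrite -scalerA Hj scaler0.
have H0 : H \bot%O by rewrite /H/mkset idem_valE scale0r.
have [q qub [i ipart [i0 Hi]]] := local_on_supremum Hdown H0.
have qx : val q *: x = 0.
  apply: Msep; exists i => // -[|n]; rewrite scaler0 scalerA.
    by rewrite i0 scale0r.
  by rewrite mulrC -scalerA (Hi n) scaler0.
have minq : val (idem_compl q) *: x = x /\
    forall j : idem R, val j *: x = x -> (idem_compl q <= j)%O.
  split=> [|j jx]; first by rewrite idem_valE scalerBl scale1r qx subr0.
  have : (idem_compl j <= q)%O.
    by apply: qub; rewrite /H/mkset idem_valE scalerBl scale1r jx subrr.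
  move=> /idem_leE; rewrite idem_valE => jq.
  apply/idem_leE; rewrite idem_valE.
  apply/eqP; rewrite -subr_eq0; apply/eqP.
  transitivity ((1 - val j) * val q - (1 - val j)); first by ring.
  by rewrite jq subrr.
pose P := [set i : idem R | val i *: x = x] `&` lbound [set i : idem R | val i *: x = x].
have PP : P (idem_compl q) by [].
exact: (xgetI \bot%O PP).
Qed.

Lemma supp_scale x : val (supp x) *: x = x.
Proof. by have [] := suppP x. Qed.

Lemma supp_min x i : val i *: x = x -> (supp x <= i)%O.
Proof. by have [_] := suppP x; apply. Qed.

Lemma supp_annihil x i : val i *: x = 0 -> val i * val (supp x) = 0.
Proof.
move=> ix; have /supp_min/idem_le_mul : val (idem_compl i) *: x = x.
  by rewrite idem_valE scalerBl scale1r ix subr0.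
rewrite idem_valE => <-; ring: (idemK i).
Qed.

Lemma supp0 : supp (0 : M) = \bot%O.
Proof. by apply/le_anti; rewrite le0x supp_min // scaler0. Qed.

Lemma supp_eq0 x : supp x = \bot%O -> x = 0.
Proof. by move=> x0; rewrite -[x]supp_scale x0 idem_valE scale0r. Qed.
End Module.

Section Invertible.
Hypothesis Rsep : separated_by_partitions R^o.
Hypothesis Rinv : quasi_invertible R.

(** Since [a] and [i] generate the same ideal, [a *: y] and [i *: y] lie in the
    same submodules. *)
Lemma idempotent_associate (a : R) :
  exists (b : R) (i : idem R), b * a = val i /\ a * val i = a.
Proof.
have [b _ ba] := Rinv a; exists b, (supp (a : R^o)); split=> //.
by rewrite mulrC; exact: (@supp_scale R^o Rsep a).
Qed.

(** Condition (c) of a quasi-basis therefore says that the terms [a j *: x j] of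
    a vanishing sum vanish. *)
Lemma annihil_supp (M : lmodType R) (Msep : separated_by_partitions M)
    (a : R) (x : M) :
  a *: x = 0 -> a * val (supp x) = 0.
Proof.
move=> ax; have [b [i [ba ai]]] := idempotent_associate a.
by rewrite -ai -mulrA supp_annihil ?mulr0// -ba -scalerA ax scaler0.
Qed.
End Invertible.
End Supports.

(** * Building a quasi-basis *)

Section Existence.
Variable R : comPzRingType.
Hypothesis Icomplete : idem_complete R.
Hypothesis Icountable : idem_countable_type R.
Hypothesis Rinv : quasi_invertible R.
Hypothesis Rconcat : countable_concatenation R.
Hypothesis Rsep : separated_by_partitions R^o.
Variable M : lmodType R.
Hypothesis Msep : separated_by_partitions M.
Implicit Types (x : nat -> M) (y z : M) (n : nat) (a : nat -> R).

Let supp_id := supp_scale Icomplete Icountable Msep.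
Let supp_le := supp_min Icomplete Icountable Msep.

(** Families are indexed by [nat] and cut at [n], so that the neighbours of an
    index need no casts between ordinal types. *)
Definition in_span n x y := exists a, y = \sum_(k < n) a k *: x k.

Lemma in_spanD n x y z : in_span n x y -> in_span n x z -> in_span n x (y + z).
Proof.
move=> [a ->] [b ->]; exists (fun k => a k + b k); rewrite -big_split.
by apply: eq_bigr => k _; rewrite scalerDl.
Qed.

Lemma in_spanZ n x c y : in_span n x y -> in_span n x (c *: y).
Proof.
move=> [a ->]; exists (fun k => c * a k); rewrite scaler_sumr.
by apply: eq_bigr => k _; rewrite scalerA.
Qed.

Lemma in_span_sum n x m (F : nat -> M) :
  (forall k, (k < m)%N -> in_span n x (F k)) -> in_span n x (\sum_(k < m) F k).
Proof.
move=> HF; apply: (big_ind (in_span n x)).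
- by exists (fun=> 0); rewrite big1 // => k _; rewrite scale0r.
- exact: in_spanD.
- by move=> k _; exact: HF.
Qed.

Lemma in_span_gen n x k : (k < n)%N -> in_span n x (x k).
Proof.
move=> kn; exists (fun j => (j == k)%:R).
rewrite (bigD1 (Ordinal kn)) //= eqxx scale1r big1 ?addr0 // => j.
by rewrite -val_eqE /= => /negPf ->; rewrite scale0r.
Qed.

Lemma in_span_trans n x m x' y :
  (forall k, (k < n)%N -> in_span m x' (x k)) -> in_span n x y -> in_span m x' y.
Proof.
by move=> xx' [a ->]; apply: (in_span_sum (F := fun k => a k *: x k)) => k /xx' /in_spanZ.
Qed.

(** Over an exhausting partition the coefficients on the pieces are glued into
    single ring elements by concatenation, so the supremum of the idempotents
    carrying [y] into the span still does. *)
Lemma largest_part_in_span n x y :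
  exists q : idem R, in_span n x (val q *: y) /\
    forall i : idem R, in_span n x (val i *: y) -> (i <= q)%O.
Proof.
pose H : set (idem R) := [set i | in_span n x (val i *: y)].
have Hdown i j : H j -> (i <= j)%O -> H i.
  rewrite /H/mkset => Hj /idem_le_mul <-; rewrite -scalerA; exact: in_spanZ.
have H0 : H \bot%O.
  rewrite /H/mkset idem_valE scale0r -(scale0r (0 : M)).
  by apply: in_spanZ; exists (fun=> 0); rewrite big1 // => k _; rewrite scale0r.
have [q qub [i ipart [i0 Hi]]] := local_on_supremum Icomplete Icountable Hdown H0.
exists q; split=> //.
have [a Ha] := choice Hi.
have /choice [b Hb] k : exists b : R,
    forall m, val (i m) * b = val (i m) * (if m is m'.+1 then a m' k else 0).
  exact: Rconcat.
exists (fun k => val q * b k).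
apply: Msep; exists i => // -[|m].
  rewrite scalerA i0 scale0r scaler_sumr big1 // => k _.
  by rewrite scalerA mulrA i0 mul0r scale0r.
have iq : val (i m.+1) * val q = val (i m.+1) by apply/idem_le_mul/qub/Hi.
rewrite scalerA iq -{1}(idemK (i m.+1)) -scalerA Ha !scaler_sumr.
by apply: eq_bigr => k _; rewrite !scalerA mulrA iq Hb.
Qed.

Definition direct_to n x y := forall c, in_span n x (c *: y) -> c *: y = 0.

(** With [q] the largest part of [y] in the span, [z = (1 - q) y] works: if
    [c *: z] is in the span then so is [i *: z] for the idempotent [i] associated
    with [c], whence [i (1 - q) <= q] and [i (1 - q) = 0]. *)
Lemma direct_complement n x y :
  exists z, in_span n x (y - z) /\ direct_to n x z.
Proof.
have [q [qy qmax]] := largest_part_in_span n x y.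
exists (val (idem_compl q) *: y); split=> [|c].
  by rewrite idem_valE scalerBl scale1r opprB addrCA subrr addr0.
have [b [i [bc ci]]] := idempotent_associate Icomplete Icountable Rsep Rinv c.
move=> /(in_spanZ b); rewrite !scalerA bc -idem_val_meet => /qmax/idem_le_mul.
rewrite !idem_valE => E.
have i0 : val i * (1 - val q) = 0 by rewrite -E; ring: (idemK q).
by rewrite -ci -mulrA i0 mulr0 scale0r.
Qed.

Definition independent n x := forall a,
  \sum_(k < n) a k *: x k = 0 -> forall k, (k < n)%N -> a k *: x k = 0.

(** Null vectors beyond [n] make the supports decrease to 0, so that the gaps
    between consecutive supports sum up to 1. *)
Definition nested n x :=
  (forall k, (n <= k)%N -> x k = 0) /\
  (forall k, (supp (x k.+1) <= supp (x k))%O).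

Section Insertion.
Variables (n : nat) (x : nat -> M).
Hypothesis xnested : nested n x.

(** The support preceding that of [x k], the unit coming before [x 0]. *)
Definition upper k : idem R := if k is j.+1 then supp (x j) else \top%O.

(** The region where [x k] is the first vector of the family to vanish. *)
Definition gap k : R := val (upper k) - val (upper k.+1).

Definition insert y k : M := x k + gap k *: y.

Lemma upper_anti j k : (j <= k)%N -> val (upper k) * val (upper j) = val (upper k).
Proof.
move=> jk; apply/idem_leE; rewrite -(subnK jk).
elim: (k - j)%N => [|m IH].
  exact: lexx.
apply: le_trans IH.
by rewrite addSn; case: (m + j)%N => [|l] /=; [exact: lex1 | have [_] := xnested].
Qed.

Lemma gap_idem k : gap k * gap k = gap k.
Proof.
rewrite /gap; ring: (idemK (upper k)) (idemK (upper k.+1)) (upper_anti (leqnSn k)).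
Qed.

Lemma gap_orth j k : j != k -> gap j * gap k = 0.
Proof.
have orth_lt l m : (l < m)%N -> gap l * gap m = 0.
  move=> lm; have [le_lm le_lm1] := (ltnW lm, leqW (ltnW lm)).
  by rewrite mulrC /gap mulrBr !mulrBl !upper_anti ?subrr.
by rewrite neq_ltn => /orP[/orth_lt//|/orth_lt]; rewrite mulrC.
Qed.

Lemma gap_scale k : gap k *: x k = 0.
Proof.
rewrite /gap scalerBl [X in _ - X]/= supp_id.
by rewrite -{1}(supp_id (x k)) scalerA mulrC (upper_anti (leqnSn k)) supp_id subrr.
Qed.

Lemma gap_insert y k : gap k *: insert y k = gap k *: y.
Proof. by rewrite scalerDr gap_scale add0r scalerA gap_idem. Qed.

Lemma supp_insert y k : val (supp (x k)) *: insert y k = x k.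
Proof.
rewrite scalerDr supp_id scalerA /gap mulrBr [upper k.+1]/= idemK.
by rewrite (upper_anti (leqnSn k)) subrr scale0r addr0.
Qed.

(** The old support of [x k] separates the new supports: it lies below that of
    [insert y k] and above that of [insert y k.+1]. *)
Lemma insert_nested y : nested n.+1 (insert y).
Proof.
split=> [[//|k]|k].
  rewrite ltnS => nk; have [x0 _] := xnested.
  by rewrite /insert /gap /upper !x0 ?leqW // subrr scale0r addr0.
have mid : (supp (x k) <= supp (insert y k))%O.
  apply: supp_le; rewrite -{1}(supp_insert y k) scalerA mulrC -scalerA supp_id.
  exact: supp_insert.
apply: le_trans mid; apply: supp_le.
have -> : val (supp (x k)) = val (upper k.+1) by [].
rewrite scalerDr scalerA /gap mulrBr idemK.
rewrite [_ * val (upper k.+2)]mulrC (upper_anti (leqnSn k.+1)); congr (_ + _).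
by rewrite -{1}(supp_id (x k.+1)) scalerA mulrC (upper_anti (leqnSn k.+1)) supp_id.
Qed.

Lemma insert_span_old y k : (k < n)%N -> in_span n.+1 (insert y) (x k).
Proof.
by move=> kn; rewrite -(supp_insert y k); apply/in_spanZ/in_span_gen/leqW.
Qed.

Lemma sum_gap : \sum_(k < n.+1) gap k = 1.
Proof.
rewrite -(big_mkord xpredT gap).
have := @telescope_sumr R 0 n.+1 (fun k => - val (upper k)) isT.
rewrite [val (upper n.+1)]/= (proj1 xnested) // supp0 // idem_valE.
rewrite idem_valE oppr0 add0r opprK => <-.
by apply: eq_bigr => k _; rewrite /gap opprK addrC.
Qed.

(** The coefficient [gap k] extracts from [insert y k] exactly the part of [y]
    that was put there. *)
Lemma insert_span_new y : in_span n.+1 (insert y) y.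
Proof.
exists gap; rewrite -{1}[y]scale1r -sum_gap scaler_suml.
by apply: eq_bigr => k _; rewrite gap_insert.
Qed.

(** A relation splits into a relation among the [x k] and one on [y]. The second
    has coefficient [\sum_k a k * gap k], from which the orthogonal gaps isolate
    each [a k]. *)
Lemma insert_independent y :
  independent n x -> direct_to n x y -> independent n.+1 (insert y).
Proof.
move=> xind ydir a; rewrite /insert.
under eq_bigr do rewrite scalerDr scalerA.
rewrite big_split -scaler_suml => /= E.
have xn : x n = 0 by case: xnested => ->.
have Ex : \sum_(k < n.+1) a k *: x k = \sum_(k < n) a k *: x k.
  by rewrite big_ord_recr /= xn scaler0 addr0.
rewrite Ex in E; set c := \sum_(k < n.+1) _ in E.
have cy : c *: y = 0.
  apply: ydir; have -> : c *: y = - 1 *: \sum_(k < n) a k *: x k.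
    by rewrite scaleN1r; apply/eqP; rewrite -addr_eq0 addrC E.
  by apply: in_spanZ; exists a.
rewrite cy addr0 in E => k; rewrite ltnS scalerDr => kn.
have -> : a k *: x k = 0.
  by move: kn; rewrite leq_eqVlt => /predU1P[->|/(xind _ E)//]; rewrite xn scaler0.
rewrite add0r scalerA.
have -> : a k * gap k = gap k * c.
  rewrite mulr_sumr (bigD1 (Ordinal (kn : (k < n.+1)%N))) //= big1 ?addr0.
    by rewrite mulrCA gap_idem.
  by move=> j jk; rewrite mulrCA gap_orth ?mulr0 // eq_sym.
by rewrite -scalerA cy scaler0.
Qed.
End Insertion.

Lemma nested_independent_span n (g : nat -> M) :
  exists x, [/\ nested n x, independent n x &
                forall k, (k < n)%N -> in_span n x (g k)].
Proof.
elim: n => [|n [x [xnest xind xg]]].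
  exists (fun=> 0); split=> //; split=> // k; exact: lexx.
have [z [gz zdir]] := direct_complement n x (g n).
have old := insert_span_old xnest z.
exists (insert x z); split.
- exact: insert_nested.
- exact: insert_independent.
move=> k; rewrite ltnS leq_eqVlt => /predU1P[->|/xg/(in_span_trans old)//].
rewrite -(subrK z (g n)); apply: in_spanD; first exact: in_span_trans gz.
exact: insert_span_new.
Qed.

Definition extend (T : Type) (t0 : T) n (f : 'I_n -> T) (k : nat) : T :=
  oapp f t0 (insub k).

Lemma extendE (T : Type) (t0 : T) n (f : 'I_n -> T) (j : 'I_n) :
  extend t0 f j = f j.
Proof. by rewrite /extend valK. Qed.

Lemma quasi_basis_exists : finitely_generated M ->
  exists n (x : 'I_n -> M), quasi_basis x.
Proof.
move=> [n [g gspan]].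
have [x [xnest xind xg]] := nested_independent_span n (extend 0 g).
exists n, (fun k => x k); split.
- move=> y; have [a ya] := gspan y.
  have /(in_span_trans xg) [b ->] : in_span n (extend 0 g) y.
    by exists (extend 0 a); rewrite ya; apply: eq_bigr => k _; rewrite !extendE.
  by exists (fun k => b k).
- by move=> j k jk; apply/idem_leE; exact: (upper_anti xnest (j := j.+1) (k := k.+1)).
- move=> a Ea j.
  apply: (annihil_supp Icomplete Icountable Rsep Rinv Msep).
  rewrite -(extendE 0 a j); apply: (xind (extend 0 a)) => //.
  by rewrite -[RHS]Ea; apply: eq_bigr => k _; rewrite extendE.
Qed.

(** Supports decrease, so if any vector vanishes then the last one does. *)
Lemma quasi_basis_trim n (x : 'I_n -> M) : quasi_basis x ->
  exists m (y : 'I_m -> M), quasi_basis y /\ forall j, y j <> 0.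
Proof.
elim: n x => [|n IH] x [xspan xanti xind]; first by exists 0%N, x; split=> // -[].
have [xn|xn] := pselect (x ord_max = 0); last first.
  exists n.+1, x; split=> // j xj; apply: xn.
  apply: (supp_eq0 Icomplete Icountable Msep); apply/le_anti; rewrite le0x andbT.
  by rewrite -(supp0 Icomplete Icountable Msep) -xj xanti // -ltnS ltn_ord.
apply: (IH (fun k => x (widen_ord (leqnSn n) k))); split.
- move=> y; have [a ->] := xspan y.
  exists (fun k => a (widen_ord (leqnSn n) k)).
  by rewrite big_ord_recr /= xn scaler0 addr0.
- by move=> j k jk; apply: xanti.
- move=> a Ea j; have wE k : extend 0 a (widen_ord (leqnSn n) k) = a k.
    by rewrite -[LHS]/(extend 0 a k) extendE.
  rewrite -wE; apply: (xind (fun k => extend 0 a k)).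
  rewrite big_ord_recr /= xn scaler0 addr0 -[RHS]Ea.
  by apply: eq_bigr => k _; rewrite -[X in X *: _]/(extend 0 a k) extendE.
Qed.

End Existence.

(** * Uniqueness of the supports *)

Section Uniqueness.
Variable R : comPzRingType.

(** Pad the two factors to square matrices; the left one has a zero column. *)
Lemma det_mulmx_narrow d k (U : 'M[R]_(k, d)) (V : 'M[R]_(d, k)) :
  (d < k)%N -> \det (U *m V) = 0.
Proof.
move=> dk; have [e ke] : exists e, k = (d + e.+1)%N.
  by exists (k - d.+1)%N; rewrite addnS -addSn subnKC.
move: U V; rewrite {k dk}ke => U V.
have -> : U *m V = row_mx U (0 : 'M_(_, e.+1)) *m col_mx V 0.
  by rewrite mul_row_col mul0mx addr0.
rewrite det_mulmx (expand_det_col _ (rshift d ord_max)) big1 ?mul0r // => i _.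
by rewrite row_mxEr mxE mul0r.
Qed.

Variable M : lmodType R.
Hypothesis supp_id : forall x : M, val (supp x) *: x = x.

(** Cut down to [p], the vectors [y l] with [l < j] generate the module while
    [x 0, ..., x j] are free over [p R]. Expressing the latter through the former
    and back factors [p%:M] of size [j.+1] through size at most [j]. *)
Lemma free_rank_le n m (x : 'I_n -> M) (y : 'I_m -> M) (j : 'I_n) (p : idem R) :
    quasi_basis x -> spanning y -> (p <= supp (x j))%O ->
    (forall l : 'I_m, (j <= l)%N -> val p *: y l = 0) ->
  p = \bot%O.
Proof.
move=> [xspan xanti xind] yspan pj py.
have [A xA] := choice (fun i => yspan (x i)).
have [B yB] := choice (fun l => xspan (y l)).
have jn : (j.+1 <= n)%N by [].
have dm : (minn m j <= m)%N by exact: geq_minl.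
pose w := widen_ord jn; pose v := widen_ord dm.
pose U := \matrix_(i < j.+1, l < minn m j) (val p * A (w i) (v l)).
pose V := \matrix_(l < minn m j, r < j.+1) B (v l) (w r).
have UV : (val p)%:M = U *m V.
  apply/matrixP => i r; rewrite !mxE.
  under eq_bigr do rewrite !mxE -mulrA.
  rewrite -mulr_sumr.
  pose C r' := \sum_(l < minn m j) A (w i) (v l) * B (v l) r'.
  (* The round trip from x to y and back, in which p kills the y l with l >= j. *)
  have px : val p *: x (w i) = \sum_r' (val p * C r') *: x r'.
    rewrite {1}xA scaler_sumr (bigID (fun l : 'I_m => (l < minn m j)%N)) /=.
    rewrite [X in _ + X]big1 ?addr0 => [|l]; last first.
      rewrite ltn_min ltn_ord /= -leqNgt => jl.
      by rewrite scalerA mulrC -scalerA py ?scaler0.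
    rewrite (big_ord_narrow dm) -/v.
    transitivity (\sum_(l < minn m j) \sum_r'
        val p *: (A (w i) (v l) *: (B (v l) r' *: x r'))).
      by apply: eq_bigr => l _; rewrite {1}yB !scaler_sumr.
    rewrite exchange_big; apply: eq_bigr => r' _.
    rewrite mulr_sumr scaler_suml; apply: eq_bigr => l _.
    by rewrite !scalerA mulrA.
  have := xind (fun r' => (r' == w i)%:R * val p - val p * C r').
  have -> : \sum_r' ((r' == w i)%:R * val p - val p * C r') *: x r' = 0.
    under eq_bigr do rewrite scalerBl.
    rewrite sumrB -px (bigD1 (w i)) //= eqxx mul1r big1 ?addr0 ?subrr // => r'.
    by move=> /negPf ->; rewrite mul0r scale0r.
  move=> /(_ erefl (w r)) Er.
  (* The relation only holds up to the support of x r, which contains p. *)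
  have pr : val p * val (supp (x (w r))) = val p.
    by apply/idem_leE/(le_trans pj)/xanti; exact: (ltn_ord r).
  have : ((w r == w i)%:R * val p - val p * C (w r)) * (val p * val (supp (x (w r)))) = 0.
    by rewrite mulrCA Er mulr0.
  rewrite pr mulrBl -mulrA idemK mulrAC idemK => /eqP; rewrite subr_eq0 => /eqP <-.
  have -> : (w r == w i) = (i == r) by rewrite eq_sym -!val_eqE.
  by rewrite mulr_natl.
have := det_scalar j.+1 (val p); rewrite UV det_mulmx_narrow ?ltnS ?geq_minr //.
have pow k : val p ^+ k.+1 = val p by elim: k => [|k IH]; rewrite ?expr1 // exprS IH idemK.
by rewrite pow => p0; apply/val_inj; rewrite -p0 idem_valE.
Qed.

(** [free_rank_le] on the region where [x j] is alive and [y k] is dead. *)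
Lemma supp_le_quasi_basis n m (x : 'I_n -> M) (y : 'I_m -> M) (j : 'I_n) (k : 'I_m) :
    quasi_basis x -> quasi_basis y -> j = k :> nat ->
  (supp (x j) <= supp (y k))%O.
Proof.
move=> xqb yqb jk; have [yspan yanti _] := yqb.
pose p := (supp (x j) `&` idem_compl (supp (y k)))%O.
have p0 : p = \bot%O.
  apply: (free_rank_le xqb yspan (leIl _ _)) => l; rewrite jk => kl.
  rewrite -[y l]supp_id scalerA !idem_valE.
  have /idem_le_mul <- := yanti _ _ kl.
  suff -> : val (supp (x j)) * (1 - val (supp (y k))) *
            (val (supp (y l)) * val (supp (y k))) = 0 by rewrite scale0r.
  by ring: (idemK (supp (y k))).
apply/idem_leE; move/(congr1 val): p0; rewrite !idem_valE mulrBr mulr1 => /eqP.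
by rewrite subr_eq0 => /eqP <-.
Qed.

Lemma quasi_basis_length_le n m (x : 'I_n -> M) (y : 'I_m -> M) :
    quasi_basis x -> spanning y -> (forall j, x j <> 0) ->
  (n <= m)%N.
Proof.
move=> xqb yspan x0; rewrite leqNgt; apply/negP => mn.
apply: (x0 (Ordinal mn)); rewrite -[LHS]supp_id.
rewrite (free_rank_le xqb yspan (lexx _)) ?idem_valE ?scale0r // => l.
by rewrite leqNgt ltn_ord.
Qed.

End Uniqueness.

Theorem theorem2p4 (R : comPzRingType)
  (Icomplete : idem_complete R)
  (Icountable : idem_countable_type R)
  (Rinv : quasi_invertible R)
  (Rconcat : countable_concatenation R)
  (Rsep : separated_by_partitions R^o)
  (M : lmodType R)
  (Mfg : finitely_generated M)
  (Msep : separated_by_partitions M) :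
  (exists (n : nat) (x : 'I_n -> M),
     quasi_basis x /\ forall j, x j <> 0) /\
  (forall (n m : nat) (x : 'I_n -> M) (y : 'I_m -> M),
     quasi_basis x -> quasi_basis y ->
     ((forall j, x j <> 0) -> (forall k, y k <> 0) -> n = m) /\
     (forall (j : 'I_n) (k : 'I_m), j = k :> nat -> supp (x j) = supp (y k))).
Proof.
have supp_id := supp_scale Icomplete Icountable Msep.
split.
  have [n [x xqb]] :=
    quasi_basis_exists Icomplete Icountable Rinv Rconcat Rsep Msep Mfg.
  exact: (quasi_basis_trim Icomplete Icountable Msep xqb).
move=> n m x y xqb yqb; have [[xspan _ _] [yspan _ _]] := (xqb, yqb).
split=> [x0 y0|j k jk].
  apply/eqP; rewrite eqn_leq (quasi_basis_length_le supp_id xqb yspan x0).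
  exact: (quasi_basis_length_le supp_id yqb xspan y0).
by apply/le_anti; rewrite !(supp_le_quasi_basis supp_id).
Qed.
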